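(* Let $G$ be a finite simple graph of order $n\geq 3$ and let $k\in\{3,\ldots,n\}$ be an integer. Then $C_{k}(G)\leq n-k+2$. Moreover, equality $C_k(G)=n-k+2$ holds if and only if $n=k$ or $G\cong H\vee K_{n-k+1}$ for some graph $H$ of order $k-1$.
   Context: For a positive integer $k$, a set $S\subseteq V(G)$ is a $k$-dominating set of $G$ if every vertex $v\in V(G)\setminus S$ has at least $k$ neighbors in $S$. Two disjoint sets $A,B\subseteq V(G)$ form a $k$-coalition if neither $A$ nor $B$ is a $k$-dominating set of $G$ but $A\cup B$ is a $k$-dominating set of $G$. A $k$-coalition partition of $G$ is a partition $\Theta$ of $V(G)$ such that every set in $\Theta$ is either a $k$-dominating set of cardinality $k$ or forms a $k$-coalition with another set of $\Theta$. The $k$-coalition number $C_k(G)$ is the maximum cardinality of a $k$-coalition partition of $G$. The join $G\vee H$ of graphs $G$ and $H$ is obtained from their disjoint union by adding all edges $gh$ with $g\in V(G)$, $h\in V(H)$. *)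

(* Defs.v *)
From mathcomp Require Import all_boot.

Set Implicit Arguments.
Unset Strict Implicit.
Unset Printing Implicit Defensive.

Record sgraph := SGraph {
  vertex :> finType;
  adj : rel vertex;
  adj_sym : symmetric adj;
  adj_irrefl : irreflexive adj }.

Definition neighbors (G : sgraph) (v : G) : {set G} := [set u | adj v u].

Definition isomorphic (G H : sgraph) : Prop :=
  exists2 f : G -> H, bijective f & forall x y : G, adj (f x) (f y) = adj x y.

Section Join.
Variables G H : sgraph.

Definition join_adj (x y : G + H) : bool :=
  match x, y with
  | inl a, inl b => adj a b
  | inr a, inr b => adj a b
  | _, _ => true
  end.

Fact join_adj_sym : symmetric join_adj.
Proof. by move=> [a|a] [b|b] //=; rewrite adj_sym. Qed.

Fact join_adj_irrefl : irreflexive join_adj.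
Proof. by move=> [a|a] /=; rewrite adj_irrefl. Qed.

Definition join : sgraph := SGraph join_adj_sym join_adj_irrefl.
End Join.

Section Complete.
Variable m : nat.

Definition complete_adj (i j : 'I_m) : bool := i != j.

Fact complete_adj_sym : symmetric complete_adj.
Proof. by move=> i j; rewrite /complete_adj eq_sym. Qed.

Fact complete_adj_irrefl : irreflexive complete_adj.
Proof. by move=> i; rewrite /complete_adj eqxx. Qed.

Definition complete : sgraph := SGraph complete_adj_sym complete_adj_irrefl.
End Complete.

Section Coalition.
Variables (G : sgraph) (k : nat).
Implicit Types (S A B : {set G}) (P : {set {set G}}).

Definition k_dominating S : bool :=
  [forall v in ~: S, k <= #|neighbors v :&: S|].

Definition k_coalition A B : bool :=
  [&& [disjoint A & B], ~~ k_dominating A, ~~ k_dominating B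
    & k_dominating (A :|: B)].

(* The blocks of a mathcomp [partition] are nonempty. *)
Definition k_coalition_partition P : bool :=
  partition P [set: G] &&
  [forall A in P,
     (k_dominating A && (#|A| == k))
     || [exists B in P, (B != A) && k_coalition A B]].

(* The value is 0 if there is no k-coalition partition.  This does not happen
   when 2 <= k <= #|G|: an inclusion-maximal set that is not k-dominating,
   together with the singletons of its complement, is one. *)
Definition coalition_number : nat :=
  \max_(P : {set {set G}} | k_coalition_partition P) #|P|.
End Coalition.

(* Main.v *)
Require Import Defs.
From mathcomp Require Import all_boot.
From mathcomp Require Import zify.

(** When k <= n, a k-dominating set has at least k vertices, so the union of
    two coalition partners A, B has at least k vertices, and the other blocks,
    being nonempty, number at most n - k.  In case of equality
    |A| + |B| = k and all other blocks are singletons.  If moreover n > k, a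
    block outside {A, B} is a singleton, so its partner has k - 1 >= 2 elements;
    hence there is one block D of size k - 1, all other blocks are singletons,
    and each of them is a partner of D.  A vertex outside D + c has only k
    potential neighbours in D + c, so it is adjacent to all of them; as c ranges
    over the complement of D, every vertex outside D is adjacent to all other
    vertices. *)

Lemma k_dominating_card (G : sgraph) k (S : {set G}) :
  k <= #|G| -> k_dominating k S -> k <= #|S|.
Proof.
move=> lekG /forall_inP domS.
have [S0 | [v vS]] := set_0Vmem (~: S).
  by move: lekG; rewrite -cardsT -(setCK S) S0 setC0.
exact: leq_trans (domS _ vS) (subset_leq_card (subsetIr _ _)).
Qed.

(** Each block outside [Q] is nonempty, so it contributes at least 1 to [#|D|], and exactly 1 when
    it is a singleton. Keeping [#|P|] and [#|Q|] on opposite sides avoids truncated subtraction. *)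
Lemma card_partition_sub {T : finType} (P Q : {set {set T}}) (D : {set T}) :
    partition P D -> Q \subset P ->
  \sum_(A in Q) #|A| + #|P| <= #|D| + #|Q|
    ?= iff [forall A in P :\: Q, #|A| == 1].
Proof.
move=> partP sQP; rewrite -(cardsID Q P) (setIidPr sQP) [#|Q| + _]addnC addnA.
rewrite (card_partition partP) [\sum_(A in P) _](big_setID Q) /= (setIidPr sQP).
rewrite /leqif leq_add2r eqn_add2r leq_add2l eqn_add2l -sum1_card.
apply: leqif_sum => A /setDP[AP _]; rewrite eq_sym.
by apply: leqif_eq; rewrite card_gt0 (partition_neq0 partP).
Qed.

(** The block [A] is arbitrary so that, in the extremal case, a partner can be extracted for any
    chosen block. *)
Lemma k_coalition_partition_card (G : sgraph) k (P : {set {set G}}) (A : {set G}) :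
    k <= #|G| -> k_coalition_partition k P -> A \in P ->
  #|P| <= #|G| - k + 2 /\
  (#|P| = #|G| - k + 2 ->
   exists2 B, B \in P &
     [/\ B != A, k_dominating k (A :|: B), #|A| + #|B| = k
       & forall C, C \in P -> C != A -> C != B -> #|C| = 1]).
Proof.
move=> lekG /andP[partP /forall_inP coalP] AP.
case/orP: (coalP _ AP) => [/andP[_ /eqP cardA] | /exists_inP[B BP]].
  (* Counting with [A] alone gives [#|P| <= #|G| - k + 1], so equality cannot occur here. *)
  have sAP : [set A] \subset P by rewrite sub1set.
  have [] := card_partition_sub _ _ _ partP sAP.
  by rewrite big_set1 cardsT cards1 => leA _; split=> [|cardP]; lia.
case/andP=> neBA /and4P[disAB _ _ domAB].
have sABP : [set A; B] \subset P by rewrite subUset !sub1set AP.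
have neAB : A \notin [set B] by rewrite inE eq_sym.
have := card_partition_sub _ _ _ partP sABP.
rewrite big_setU1 //= big_set1 cardsT cards2 eq_sym neBA /= => sizeP.
have [leP _] := sizeP; have := k_dominating_card _ _ _ lekG domAB.
rewrite cardsU disjoint_setI0 // cards0 subn0 => lekAB.
split=> [|cardP]; first by lia.
exists B => //; split=> //; first by lia.
(* By [cardP] and [lekAB] the inequality in [sizeP] is tight, so its equality condition holds. *)
have := geq_leqif sizeP; case: leqP => [_ | ltP _];
  last by clear -ltP cardP lekAB lekG; lia.
move=> /esym/forall_inP one C CP neCA neCB; apply/eqP/one.
by rewrite !inE negb_or neCA neCB.
Qed.

Lemma coalition_number_le (G : sgraph) k :
  k <= #|G| -> coalition_number G k <= #|G| - k + 2.
Proof.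
move=> lekG; apply/bigmax_leqP => P coalP.
have [->|[A AP]] := set_0Vmem P; first by rewrite cards0.
by have [] := k_coalition_partition_card _ _ _ _ lekG coalP AP.
Qed.

Lemma extremal_k_coalition_partition (G : sgraph) k (P : {set {set G}}) :
    2 < k < #|G| -> k_coalition_partition k P -> #|P| = #|G| - k + 2 ->
  exists2 D : {set G}, #|D| = k.-1 &
    forall c, c \notin D -> k_dominating k (c |: D).
Proof.
case/andP=> gt2k ltkG coalP cardP; have lekG := ltnW ltkG.
have partner A (AP : A \in P) :=
  (k_coalition_partition_card _ _ _ _ lekG coalP AP).2 cardP.
have partP : partition P [set: G] by case/andP: coalP.
have [A AP] : exists A, A \in P by apply/card_gt0P; lia.
have [B BP [neBA _ cardAB oneAB]] := partner A AP.
(* Since [k < #|G|], there are at least three blocks. *)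
have [C] : exists C, C \in P :\: [set A; B].
  apply/card_gt0P; have := cardsID [set A; B] P.
  have := subset_leq_card (subsetIr P [set A; B]).
  by rewrite cards2; lia.
rewrite !inE negb_or => /andP[/andP[neCA neCB] CP].
have C1 := oneAB _ CP neCA neCB.
have [D DP [neDC _ cardCD oneCD]] := partner C CP.
exists D => [|c cD]; first by move: cardCD; rewrite C1; clear; lia.
have oneD E : E \in P -> E != D -> #|E| = 1.
  by move=> EP neED; case: (eqVneq E C) => [-> // | /oneCD]; apply.
have cP : c \in cover P by rewrite (cover_partition partP) inE.
have EP := pblock_mem cP; have cE : c \in pblock P c by rewrite mem_pblock.
have neED : pblock P c != D by apply: contraNneq cD => <-.
have E1 := oneD _ EP neED.
have defE : pblock P c = [set c].
  by apply/esym/eqP; rewrite eqEcard sub1set cE E1 cards1.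
have [F FP [_ domF cardF _]] := partner _ EP.
have -> : c |: D = pblock P c :|: F; last by [].
(* If [F] were not [D], two singletons would have total size [k], against [2 < k]. *)
rewrite defE; case: (eqVneq F D) => [-> // | /(oneD _ FP) F1].
by move: gt2k; rewrite -cardF E1 F1.
Qed.

(** The witness is [D] together with the singletons of its complement. None of these blocks reaches
    size [k], so none is k-dominating, and [D] is a partner of every singleton. *)
Lemma coalition_number_ge (G : sgraph) k (D : {set G}) :
    1 < k <= #|G| -> #|D| = k.-1 ->
    (forall c, c \notin D -> k_dominating k (c |: D)) ->
  #|G| - k + 2 <= coalition_number G k.
Proof.
case/andP=> gt1k lekG cardD domD.
have Dn0 : D != set0 by rewrite -card_gt0; lia.
have cardDC := cardsC D.
pose Q := [set [set c] | c in ~: D].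
have trivQ : trivIset Q.
  apply/trivIsetP => _ _ /imsetP[a _ ->] /imsetP[b _ ->] neab.
  by rewrite disjoints1 inE; apply: contraNneq neab => ->.
have Q0 : set0 \notin Q.
  by apply/imsetP => -[c _ /setP/(_ c)]; rewrite !inE eqxx.
have disDQ (E : {set G}) : E \in Q -> [disjoint D & E].
  by case/imsetP=> c; rewrite inE => cD ->; rewrite disjoint_sym disjoints1.
have [trivP DQ] := trivIsetU1 disDQ trivQ Q0.
have small (E : {set G}) : #|E| < k -> ~~ k_dominating k E.
  by rewrite ltnNge; apply: contra; apply: k_dominating_card.
have smallD : ~~ k_dominating k D by apply: small; lia.
have small1 (c : G) : ~~ k_dominating k [set c] by apply: small; rewrite cards1.
have cardP : #|D |: Q| = #|G| - k + 2.
  by rewrite cardsU1 DQ card_imset; [lia | exact: set1_inj].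
rewrite -cardP /coalition_number.
apply: (leq_bigmax_cond (F := fun P : {set {set G}} => #|P|)).
apply/andP; split.
  apply/and3P; split=> //; last by rewrite !inE negb_or eq_sym Dn0.
  rewrite eqEsubset subsetT; apply/subsetP => x _; apply/bigcupP.
  have [xD|xD] := boolP (x \in D); first by exists D => //; rewrite setU11.
  by exists [set x]; rewrite ?set11 // setU1r // imset_f // inE.
have coalD c : c \notin D -> k_coalition k D [set c].
  move=> cD; apply/and4P; split=> //; first by rewrite disjoint_sym disjoints1.
  by rewrite setUC domD.
have neD c : c \notin D -> [set c] != D.
  by apply: contraNneq => <-; rewrite set11.
apply/forall_inP => E /setU1P[-> | /imsetP[c]].
  have [c] : exists c, c \in ~: D by apply/card_gt0P; lia.
  rewrite inE => cD; apply/orP; right; apply/exists_inP; exists [set c].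
    by rewrite setU1r // imset_f // inE.
  by rewrite neD ?coalD.
rewrite inE => cD ->; apply/orP; right; apply/exists_inP; exists D.
  by rewrite setU11.
rewrite eq_sym neD //=; have /and4P[dis dD dc dU] := coalD c cD.
by apply/and4P; split; rewrite // 1?disjoint_sym 1?setUC.
Qed.

Lemma k_dominating_setU1_universal (G : sgraph) k (D : {set G}) :
    0 < k < #|G| -> #|D| = k.-1 ->
  (forall c, c \notin D -> k_dominating k (c |: D)) <->
  (forall u v, v \notin D -> u != v -> adj v u).
Proof.
case/andP=> k_gt0 ltkG cardD.
have cardU c : c \notin D -> #|c |: D| = k by move=> cD; rewrite cardsU1 cD; lia.
split=> [dom u v vD neuv | univ c cD].
  have step c : c \notin D -> c != v -> u \in c |: D -> adj v u.
    move=> cD necv uU; have /forall_inP/(_ v) := dom c cD.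
    rewrite !inE negb_or eq_sym necv vD => /(_ isT) le_k.
    have /eqP eqU : neighbors v :&: (c |: D) == c |: D.
      by rewrite eqEcard subsetIr cardU.
    by move: uU; rewrite -eqU !inE => /andP[].
  (* For [u] outside [D], take [c = u]. For [u] in [D], any [c] outside [D] other than [v] works;
     one exists because [~: D] has [#|G| - k + 1 >= 2] elements. *)
  have [uD|uD] := boolP (u \in D); last by apply: (step u); rewrite ?setU11.
  have [c] : exists c, c \in ~: D :\ v.
    apply/card_gt0P; have := cardsC D; have := cardsD1 v (~: D).
    by rewrite inE vD; lia.
  by rewrite !inE => /andP[necv cD]; apply: (step c); rewrite ?inE ?uD ?orbT.
apply/forall_inP => v; rewrite !inE negb_or => /andP[nevc vD].
rewrite -(cardU c cD); apply/subset_leq_card/subsetP => x xU.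
rewrite !inE in xU *; rewrite xU andbT; apply: univ => //.
by case/orP: xU => [/eqP-> | xD]; [rewrite eq_sym | apply: contraNneq vD => <-].
Qed.

Lemma isomorphic_sym (G H : sgraph) : isomorphic G H -> isomorphic H G.
Proof.
by case=> f [g fK gK] adjf; exists g => [|x y]; [exists f | rewrite -adjf !gK].
Qed.

Section Induced.
Variables (G : sgraph) (D : {set G}).

Definition induced_adj (x y : {x | x \in D}) : bool := adj (val x) (val y).

Fact induced_adj_sym : symmetric induced_adj.
Proof. by move=> x y; apply: adj_sym. Qed.

Fact induced_adj_irrefl : irreflexive induced_adj.
Proof. by move=> x; apply: adj_irrefl. Qed.

Definition induced : sgraph := SGraph induced_adj_sym induced_adj_irrefl.
End Induced.

(** [D] is the copy of [H]. As [H] is arbitrary, edges inside [D] are unconstrained, and all other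
    pairs must be adjacent. *)
Lemma isomorphic_join_complete (G : sgraph) d m : #|G| = d + m ->
  (exists H : sgraph, #|H| = d /\ isomorphic G (join H (complete m))) <->
  (exists2 D : {set G}, #|D| = d &
     forall u v, v \notin D -> u != v -> adj v u).
Proof.
move=> cardG; split=> [[H [cardH [f [g fK gK] adjf]]] | [D cardD univ]].
  exists [set g (inl h) | h in [set: H]].
    by rewrite card_imset ?cardsT // => x y /(can_inj gK)[].
  move=> u v vD neuv; rewrite -adjf.
  case fv: (f v) => [h|i].
    by case/imsetP: vD; exists h; rewrite ?inE // -fv fK.
  case fu: (f u) => [h|j] //=; apply: contra_neq neuv => eqij.
  by rewrite -(fK u) -(fK v) fu fv eqij.
have cardC : m = #|~: D| by have := cardsC D; lia.
exists (induced G D); split; first by rewrite card_sig -cardD; apply: eq_card.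
apply: isomorphic_sym.
(* The left summand is included in [G]; the right one enumerates [~: D]. *)
pose g (x : join (induced G D) (complete m)) : G :=
  match x with inl a => val a | inr i => enum_val (cast_ord cardC i) end.
have gC i : g (inr i) \notin D by have := enum_valP (cast_ord cardC i); rewrite inE.
have gD a : g (inl a) \in D by apply: valP a.
have g_inj : injective g.
  move=> [a|i] [b|j] eqg.
  - by congr inl; apply: val_inj.
  - by have := gC j; rewrite -eqg gD.
  - by have := gC i; rewrite eqg gD.
  - by congr inr; apply: (cast_ord_inj (eq_n := cardC)); apply: enum_val_inj.
exists g.
  apply: inj_card_bij => //; rewrite card_sum card_ord card_sig cardG -cardD.
  by rewrite leq_add2r; apply/eq_leq/eq_card.
move=> [a|i] [b|j] //.
- by rewrite adj_sym univ ?(inj_eq g_inj).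
- by rewrite univ ?(inj_eq g_inj).
- have [->|neij] := eqVneq i j; first by rewrite !adj_irrefl.
  have neg : g (inr j) != g (inr i).
    by rewrite (inj_eq g_inj) eq_sym; apply: contra_neq neij => -[].
  by rewrite (univ _ _ (gC i) neg) /= /complete_adj neij.
Qed.

Theorem theorem2p2 (G : sgraph) (n k : nat) (hGn : #|G| = n) (hn : 3 <= n)
    (hk : 3 <= k <= n) :
  coalition_number G k <= n - k + 2 /\
  (coalition_number G k = n - k + 2 <->
   n = k \/
   exists H : sgraph,
     #|H| = k - 1 /\ isomorphic G (join H (complete (n - k + 1)))).
Proof.
subst n; case/andP: hk => gt2k lekG.
have le_num : coalition_number G k <= #|G| - k + 2 by apply: coalition_number_le.
split=> //; rewrite isomorphic_join_complete; last by lia.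
rewrite subn1.
have ge_num (D : {set G}) : #|D| = k.-1 ->
    (forall c, c \notin D -> k_dominating k (c |: D)) ->
    coalition_number G k = #|G| - k + 2.
  move=> cardD domD; apply/eqP; rewrite eqn_leq le_num.
  by apply: coalition_number_ge cardD domD; lia.
split=> [eq_num | ext].
  have [ltkG|] := ltnP k #|G|; [right | left; lia].
  (* An empty maximum would be 0, but the value is at least 2; hence some partition attains it. *)
  have [P coalP maxP] : {P : {set {set G}} | k_coalition_partition k P
      & coalition_number G k = #|P|}.
    apply: eq_bigmax_cond; rewrite lt0n; apply/eqP => /card0_eq none.
    by move: eq_num; rewrite /coalition_number big_pred0 //; lia.
  have [||D cardD domD] := extremal_k_coalition_partition _ _ _ _ coalP.
  - by rewrite gt2k.
  - by rewrite -maxP.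
  by exists D => //; apply/(k_dominating_setU1_universal _ k) => //; lia.
have := lekG; rewrite leq_eqVlt => /predU1P[eqGk | ltkG].
  (* When [k = #|G|], let [D] omit a single vertex [v]: the only [c |: D] is the whole vertex set,
     which is vacuously k-dominating. *)
  have [v _] : exists v : G, v \in G.
    by apply/card_gt0P/(leq_trans (ltnW (ltnW gt2k)) lekG).
  apply: (ge_num (~: [set v])); first by rewrite cardsC1 -eqGk.
  move=> c; rewrite !inE negbK => /eqP->.
  by apply/forall_inP => x; rewrite setUCr setCT inE.
case: ext => [|[D cardD univ]]; first by lia.
by apply: (ge_num D) => //; apply/k_dominating_setU1_universal => //; lia.
Qed.
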